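(* Let $I$ be a non-empty set and let $\mathbb{X}_i=\langle X_i,\rho_i\rangle$, $i\in I$, be pairwise disjoint, connected and reversible binary structures such that the sequence $\langle\mathbb{X}_i : i\in I\rangle$ is rich for monomorphisms. Then: (a) for all $i,j\in I$, if $|X_i|=|X_j|$ then $\mathbb{X}_i\cong\mathbb{X}_j$; (b) the disjoint union $\bigcup_{i\in I}\mathbb{X}_i=\langle\bigcup_{i\in I}X_i,\bigcup_{i\in I}\rho_i\rangle$ is reversible if and only if $\langle |X_i| : i\in I\rangle$ is a reversible sequence of cardinals.
   Context: A binary structure is a pair $\langle X,\rho\rangle$ with $X\neq\emptyset$ and $\rho\subseteq X^2$. A homomorphism $g:\langle X,\rho\rangle\to\langle Y,\sigma\rangle$ is a map with $\langle x,y\rangle\in\rho\Rightarrow\langle g(x),g(y)\rangle\in\sigma$; a monomorphism is an injective homomorphism, a condensation is a bijective homomorphism. A structure is reversible iff every condensation from it onto itself is an automorphism. $\langle X,\rho\rangle$ is connected iff the transitive closure of $\Delta_X\cup\rho\cup\rho^{-1}$ is $X^2$. A sequence of structures $\langle\mathbb{X}_i : i\in I\rangle$ is rich for monomorphisms iff for all $i,j\in I$ and every $A\subseteq X_j$ with $|A|=|X_i|$ there is a monomorphism $g:\mathbb{X}_i\to\mathbb{X}_j$ with $g[X_i]=A$. A sequence of non-zero cardinals $\langle\kappa_i:i\in I\rangle$ is reversible iff there is no non-injective surjection $f:I\to I$ such that $\kappa_j=\sum_{i\in f^{-1}[\{j\}]}\kappa_i$ for all $j\in I$. *)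

(* Defs.v *)
From Stdlib Require Import Relation_Operators.
From mathcomp Require Import all_boot.
From mathcomp Require Import boolp classical_sets functions cardinality.

Set Implicit Arguments.
Unset Strict Implicit.
Unset Printing Implicit Defensive.

Local Open Scope classical_set_scope.
Local Open Scope relation_scope.
Local Open Scope card_scope.

(* Structures live on subsets of an ambient type, so that pairwise disjointness
   and unions of structures have their literal set-theoretic meaning. *)
Record binstruct (T : Type) := BinStruct {
  carrier : set T;
  brel : set (T * T);
  carrier_neq0 : carrier !=set0;
  brel_sub : brel `<=` carrier `*` carrier }.

(* Maps between structures are represented by functions on the ambient types,
   of which only the restriction to the source carrier matters; since carriers
   are nonempty, every map between carriers extends to such a function. *)
Section Morphisms.
Context {T U : Type}.
Implicit Types (S : binstruct T) (V : binstruct U) (g : T -> U).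

Definition homomorphism S V g :=
  set_fun (carrier S) (carrier V) g /\
  forall x y, brel S (x, y) -> brel V (g x, g y).

Definition monomorphism S V g :=
  homomorphism S V g /\ set_inj (carrier S) g.

Definition condensation S V g :=
  homomorphism S V g /\ set_bij (carrier S) (carrier V) g.

Definition isomorphism S V g :=
  set_bij (carrier S) (carrier V) g /\
  forall x y, carrier S x -> carrier S y ->
    (brel S (x, y) <-> brel V (g x, g y)).

Definition isomorphic S V := exists g, isomorphism S V g.

End Morphisms.

Definition automorphism T (S : binstruct T) (g : T -> T) := isomorphism S S g.

Definition reversible T (S : binstruct T) :=
  forall g : T -> T, condensation S S g -> automorphism S g.

Definition diag T (A : set T) : set (T * T) := [set p | A p.1 /\ p.1 = p.2].

Definition trans_closure T (R : set (T * T)) : set (T * T) :=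
  [set p | clos_trans T (fun x y => R (x, y)) p.1 p.2].

Definition connected T (S : binstruct T) :=
  trans_closure (diag (carrier S) `|` brel S `|` (brel S)^-1)
  = carrier S `*` carrier S.

Definition rich_for_monomorphisms I T (X : I -> binstruct T) :=
  forall (i j : I) (A : set T),
    A `<=` carrier (X j) -> A #= carrier (X i) ->
    exists g : T -> T,
      monomorphism (X i) (X j) g /\ g @` carrier (X i) = A.

(* A sequence of cardinals is given by a family of sets K, standing for
   < |K i| : i in I >. The set D `*`` K of pairs (i, x) with D i and K i x is
   the disjoint sum of the K i, i in D, so its cardinal is the sum of the |K i|
   over D. *)
Definition reversible_cardinals I T (K : I -> set T) :=
  ~ exists f : I -> I,
      [/\ set_surj [set: I] [set: I] f,
          ~ injective f &
          forall j : I, K j #= (f @^-1` [set j]) `*`` K].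

Section Union.
Context {I T : Type} (I0 : [set: I] !=set0) (X : I -> binstruct T).

Definition union_carrier : set T := \bigcup_(i in [set: I]) carrier (X i).
Definition union_brel : set (T * T) := \bigcup_(i in [set: I]) brel (X i).

Lemma union_carrier_neq0 : union_carrier !=set0.
Proof.
by case: I0 => i _; have [x Xx] := carrier_neq0 (X i); exists x; exists i.
Qed.

Lemma union_brel_sub : union_brel `<=` union_carrier `*` union_carrier.
Proof. by move=> p [i _ /brel_sub[/= p1 p2]]; split; exists i. Qed.

Definition union_struct : binstruct T :=
  BinStruct union_carrier_neq0 union_brel_sub.

End Union.

(* Main.v *)
(** A condensation of the union maps each component, being connected, into a
single component. This yields a surjection f on indices with |X_j| equal to the
sum of the |X_i|, f i = j; if f must be injective, the condensation restricts to
condensations X_i -> X_(f i), and these are isomorphisms because richness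
provides a condensation back and X_i is reversible. Conversely, a non-injective
f with these cardinal equalities splits each X_j into pieces of sizes |X_i|,
f i = j; richness condenses X_i onto its piece, and the glued map is a
condensation that merges two components, so it cannot be an automorphism. *)
Require Import Defs.
From mathcomp Require Import all_boot.
From mathcomp Require Import boolp classical_sets functions cardinality.

Local Open Scope classical_set_scope.
Local Open Scope card_scope.

Lemma trivIset_eq {I T : Type} {K : I -> set T} {i j : I} {x : T} :
  trivIset [set: I] K -> K i x -> K j x -> i = j.
Proof. by move=> Kdisj Kix Kjx; apply: Kdisj => //; exists x. Qed.

(** By disjointness a point meets at most one prescription; [j0] is the value outside all [K i].
    With [g i _ = i] this yields an index function. *)
Lemma trivIset_glue {I T J : Type} (j0 : J) (K : I -> set T) (g : I -> T -> J) :
  trivIset [set: I] K -> exists F : T -> J, forall i x, K i x -> F x = g i x.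
Proof.
move=> Kdisj.
have /choice[F FE] : forall x, exists y, forall i, K i x -> y = g i x.
  move=> x; have [[i Kix]|noK] := pselect (exists i, K i x).
    by exists (g i x) => j Kjx; rewrite (trivIset_eq Kdisj Kix Kjx).
  by exists j0 => i Kix; case: noK; exists i.
by exists F => i x; apply: FE.
Qed.

(** The bijection must be a total function on [T], so a point of [B] serves as default. *)
Lemma card_eq_set_bij {T U : Type} {A : set T} {B : set U} :
  B !=set0 -> A #= B -> exists f, set_bij A B f.
Proof.
elim/Ppointed: U => U in B *; first by case=> b _; case: (no b).
by move=> _ /card_set_bijP.
Qed.

Lemma set_bij_card_eq {T U : Type} {A : set T} {B : set U} {f : T -> U} :
  set_bij A B f -> A #= B.
Proof. by move=> fbij; apply: (pcard_eq fbij). Qed.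

(** The kernel of [h] is an equivalence relation containing [brel S], hence also the transitive
    closure. *)
Lemma connected_eq {T J : Type} {S : binstruct T} {h : T -> J} {x y : T} :
  connected S -> (forall u v, brel S (u, v) -> h u = h v) ->
  carrier S x -> carrier S y -> h x = h y.
Proof.
move=> Sconn hS Sx Sy.
have : trans_closure
    (diag (carrier S) `|` brel S `|` (brel S)^-1)%relation (x, y).
  by rewrite Sconn.
rewrite /trans_closure /=; elim=> [u v|u v w _ -> _ ->//].
by case=> [[[_ /= ->]|/hS]|/hS ->].
Qed.

Lemma rich_condensation {I T : Type} {X : I -> binstruct T} {i j : I} :
  rich_for_monomorphisms X -> carrier (X i) #= carrier (X j) ->
  exists g, condensation (X i) (X j) g.
Proof.
move=> Xrich /card_esym Xji.
have [g [[ghom ginj] gX]] := Xrich i j _ (@subset_refl _ _) Xji.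
exists g; split=> //; split=> //; first by case: ghom.
by rewrite /set_surj gX.
Qed.

Lemma condensation_isomorphism {I T : Type} {X : I -> binstruct T} {i j : I}
    {g : T -> T} :
  reversible (X i) -> rich_for_monomorphisms X ->
  condensation (X i) (X j) g -> isomorphism (X i) (X j) g.
Proof.
move=> Xrev Xrich [[_ ghom] gbij].
have [h [[_ hhom] hbij]] :=
  rich_condensation Xrich (card_esym (set_bij_card_eq gbij)).
have hgbij := set_bij_comp gbij hbij.
have [|_ hgP] := Xrev (h \o g).
  split=> //; split; first by case: hgbij.
  by move=> x y /ghom /hhom.
split=> // x y Xx Xy; split; first exact: ghom.
(* [h] preserves the edge between [g x] and [g y], and the automorphism [h \o g] reflects it back to
   [x] and [y]. *)
by move=> /hhom; rewrite (hgP x y Xx Xy).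
Qed.

Section UnionOfStructures.
Context {I T : Type} (I0 : [set: I] !=set0) {X : I -> binstruct T}.
Hypotheses (Xdisj : trivIset [set: I] (fun i => carrier (X i)))
  (Xconn : forall i, connected (X i))
  (Xrev : forall i, reversible (X i))
  (Xrich : rich_for_monomorphisms X).

Lemma union_reversible :
  reversible_cardinals (fun i => carrier (X i)) ->
  reversible (union_struct I0 X).
Proof.
move=> Krev F [[Ffun Fhom] Fbij]; have [_ Finj Fsurj] := Fbij.
have [i0 _] := I0.
have [idx idxE] := trivIset_glue i0 _ (fun i _ => i) Xdisj.
have [pt ptP] := choice (fun i => carrier_neq0 (X i)).
(* The component hit by one chosen point; [fP] shows that all of [X i] lands there. *)
pose f i := idx (F (pt i)).
have fP i x : carrier (X i) x -> carrier (X (f i)) (F x).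
  move=> Xx; rewrite /f.
  have -> : idx (F (pt i)) = idx (F x).
    apply: (@connected_eq _ _ (X i) (idx \o F)) => //= u v uv.
    have [|k _ /brel_sub[/= Xu Xv]] := Fhom u v; first by exists i.
    by rewrite (idxE k _ Xu) (idxE k _ Xv).
  have [|k _ Xk] := Ffun x; first by exists i.
  by rewrite (idxE k).
have Fonto j y : carrier (X j) y ->
    exists i x, [/\ f i = j, carrier (X i) x & F x = y].
  move=> Xy; have [|x [i _ Xx] Fx] := Fsurj y; first by exists j.
  exists i, x; split=> //.
  by apply: (trivIset_eq Xdisj (fP i x Xx)); rewrite Fx.
have finj : injective f.
  apply: contrapT => fNinj; apply: Krev; exists f; split=> //.
    move=> j _; have [i [_ [fi _ _]]] := Fonto j _ (ptP j); by exists i.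
  (* The disjoint sum maps to [X j] by [F x]; this value determines [x], which determines its index
     by disjointness. *)
  move=> j; apply/card_esym/(@set_bij_card_eq _ _ _ _ (F \o snd)); split.
  - by move=> [i x] /= [<- /fP].
  - move=> [i x] [i' x']; rewrite !inE /= => -[_ Xx] [_ Xx'] Fxx'.
    have xx' : x = x' by apply: Finj => //; rewrite inE; [exists i|exists i'].
    by rewrite -xx' in Xx' *; rewrite (trivIset_eq Xdisj Xx Xx').
  - by move=> y /Fonto[i [x [fi Xx Fx]]]; exists (i, x).
have Fiso i : isomorphism (X i) (X (f i)) F.
  apply: condensation_isomorphism => //; split; split.
  - by move=> x /fP.
  - move=> x y xy; have [/= Xx Xy] := brel_sub xy.
    have [|k _ Fxy] := Fhom x y; first by exists i.
    have [/= Xk _] := brel_sub Fxy.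
    by rewrite (trivIset_eq Xdisj (fP _ _ Xx) Xk).
  - by move=> x /fP.
  - by move=> x y; rewrite !inE => Xx Xy; apply: Finj; rewrite inE; exists i.
  - by move=> y /Fonto[k [x [/finj <- Xx Fx]]]; exists x.
split=> // x y [i _ Xx] [i' _ Xy]; split; first exact: Fhom.
(* An edge of the union lies in a single [X j], so injectivity of [f] puts [x] and [y] in the same
   component. *)
move=> [j _ Fxy]; have [/= Xj Xj'] := brel_sub Fxy.
have fi := trivIset_eq Xdisj (fP _ _ Xx) Xj.
have fi' := trivIset_eq Xdisj (fP _ _ Xy) Xj'.
have ii' : i = i' by apply: finj; rewrite fi fi'.
rewrite -ii' in Xy; rewrite -fi in Fxy.
by exists i => //; apply/(proj2 (Fiso i) x y).
Qed.

Lemma reversible_cardinals_of_union :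
  reversible (union_struct I0 X) ->
  reversible_cardinals (fun i => carrier (X i)).
Proof.
move=> Urev [f [fsurj fNinj fcard]]; apply: fNinj.
have [i0 _] := I0; have [t0 _] := carrier_neq0 (X i0).
have [phi phiP] := choice (fun j =>
  card_eq_set_bij (carrier_neq0 (X j)) (card_esym (fcard j))).
(* [phi (f i)] need not preserve edges; only its image of the [i]-th summand is kept, as the target
   set for richness. *)
have /choice[g gP] i : exists g, monomorphism (X i) (X (f i)) g /\
    g @` carrier (X i) = (fun x => phi (f i) (i, x)) @` carrier (X i).
  have [phifun phiinj _] := phiP (f i); apply: Xrich.
    by move=> _ [x Xx <-]; apply: phifun.
  apply: inj_card_eq => x y; rewrite !inE => Xx Xy xy.
  by have [] : (i, x) = (i, y) by apply: phiinj; rewrite ?inE.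
have [F FE] := trivIset_glue t0 _ g Xdisj.
have Ffun i x : carrier (X i) x -> carrier (X (f i)) (F x).
  by move=> Xx; rewrite (FE i) //; have [[[+ _] _] _] := gP i; apply.
have Fphi i x : carrier (X i) x ->
    exists2 a, carrier (X i) a & F x = phi (f i) (i, a).
  move=> Xx; rewrite (FE i) //; have [_ gE] := gP i.
  have : (g i @` carrier (X i)) (g i x) by exists x.
  by rewrite gE => -[a Xa <-]; exists a.
(* Distinct summands have disjoint images under the injective [phi (f i)]. *)
have Fidx i i' x x' : carrier (X i) x -> carrier (X i') x' -> F x = F x' ->
    i = i'.
  move=> Xx Xx' Fxx'.
  have ff' : f i = f i'.
    by apply: (trivIset_eq Xdisj (Ffun _ _ Xx)); rewrite Fxx'; apply: Ffun.
  have [a Xa Fa] := Fphi _ _ Xx; have [a' Xa' Fa'] := Fphi _ _ Xx'.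
  have [_ phiinj _] := phiP (f i).
  have : (i, a) = (i', a') by apply: phiinj; rewrite ?inE // -Fa Fxx' Fa' ff'.
  by case.
have Fcond : condensation (union_struct I0 X) (union_struct I0 X) F.
  have FU : set_fun (union_carrier X) (union_carrier X) F.
    by move=> x [i _ /Ffun Xx]; exists (f i).
  split; split=> //.
  - move=> x y [i _ xy]; have [/= Xx Xy] := brel_sub xy.
    exists (f i) => //; rewrite (FE i x Xx) (FE i y Xy).
    by have [[[_ +] _] _] := gP i; apply.
  - move=> x y; rewrite !inE => -[i _ Xx] [i' _ Xy] Fxy.
    have ii' := Fidx _ _ _ _ Xx Xy Fxy; rewrite -ii' in Xy.
    have [[_ ginj] _] := gP i; apply: ginj; rewrite ?inE //.
    by rewrite -(FE i x Xx) -(FE i y Xy).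
  - move=> y [j _ Xy]; have [_ _ phisurj] := phiP j.
    have [[i a] [/= fi Xa] phia] := phisurj y Xy.
    have [_ gE] := gP i.
    have : ((fun x => phi (f i) (i, x)) @` carrier (X i)) y.
      by exists a => //; rewrite fi.
    rewrite -gE => -[x Xx gx]; exists x; first by exists i.
    by rewrite (FE i).
have [[_ _ Fsurj] Fiso] := Urev F Fcond.
(* [h] reads off the component of the unique preimage under [F]; it is constant
   on components because [F], as an automorphism, reflects edges. *)
have FXdisj : trivIset [set: I] (fun i => F @` carrier (X i)).
  by move=> i i' _ _ [_ [[x Xx <-] [x' Xx' /esym]]]; apply: Fidx.
have [h hE] := trivIset_glue i0 _ (fun i _ => i) FXdisj.
have hF i x : carrier (X i) x -> h (F x) = i by move=> Xx; apply: hE; exists x.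
move=> i i' fii'.
have [x Xx] := carrier_neq0 (X i); have [x' Xx'] := carrier_neq0 (X i').
rewrite -(hF i x Xx) -(hF i' x' Xx').
(* [F x] and [F x'] share the connected [X (f i)], as [f i = f i']. *)
apply: (@connected_eq _ _ (X (f i)) h) => //; last 2 first.
- exact: Ffun.
- by rewrite fii'; apply: Ffun.
move=> u v uv; have [/= Xu Xv] := brel_sub uv.
have [|y Uy Fy] := Fsurj u; first by exists (f i).
have [|z Uz Fz] := Fsurj v; first by exists (f i).
have [|k _ /brel_sub[/= Xy Xz]] := proj2 (Fiso y z Uy Uz).
  by exists (f i) => //; rewrite Fy Fz.
by rewrite -Fy -Fz (hF k y Xy) (hF k z Xz).
Qed.

End UnionOfStructures.

Theorem theorem3p1 (I T : Type) (I0 : [set: I] !=set0)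
    (X : I -> binstruct T)
    (Xdisj : trivIset [set: I] (fun i => carrier (X i)))
    (Xconn : forall i, connected (X i))
    (Xrev : forall i, reversible (X i))
    (Xrich : rich_for_monomorphisms X) :
  (forall i j : I, carrier (X i) #= carrier (X j) ->
     isomorphic (X i) (X j)) /\
  (reversible (union_struct I0 X) <->
   reversible_cardinals (fun i => carrier (X i))).
Proof.
split=> [i j /(rich_condensation Xrich)[g gcond]|].
  by exists g; apply: condensation_isomorphism.
split; first exact: reversible_cardinals_of_union.
exact: union_reversible.
Qed.
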